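(* Let $A$ be an $\ell$-controllable complete group system with generator group $(\mathcal{U},\circ)$ (for a chosen basis and labels). Let $f_u:\mathcal{U}\to\prod_{t\in\mathbf{Z}}A^t$ be the homomorphism from $(\mathcal{U},\circ)$ to the direct product group given by $f_u(\mathbf{u})=(\ldots,f_u^t(\mathbf{u}),f_u^{t+1}(\mathbf{u}),\ldots)$, where $f_u^t(\mathbf{u})=\prod_{j=0}^{\ell}\bigl(\prod_{k=j}^{\ell}\chi^t(\mathbf{g}^{[t-j,t-j+k]})\bigr)$ and $\mathbf{g}^{[t-j,t-j+k]}$ is the generator whose label is the entry $g_k^{t-j}$ of $\mathbf{u}$. Then $f_u$ is a bijection $\mathcal{U}\to A$. Hence $\operatorname{im}f_u=A$, and therefore the group system $\operatorname{im}f_u$ is $\ell$-controllable and complete.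
   Context: Let $(A^t)_{t\in\mathbf{Z}}$ be finite groups. A group system $A$ is a set of sequences $\mathbf{a}=(a^t)_{t\in\mathbf{Z}}$, $a^t\in A^t$, forming a group under componentwise operation, such that every element of $A^t$ occurs as a time-$t$ component, for each $t$. $\chi^t:A\to A^t$ is $\mathbf{a}\mapsto a^t$. $A$ is $\ell$-controllable ($\ell>0$) if for every $t\in\mathbf{Z}$ and all $\dot{\mathbf{a}},\ddot{\mathbf{a}}\in A$ there is $\mathbf{a}\in A$ agreeing with $\dot{\mathbf{a}}$ at all times $<t$ and with $\ddot{\mathbf{a}}$ at all times $\ge t+\ell$. $A$ is complete if every sequence in $\prod_t A^t$ whose restriction to each finite interval is the restriction of some element of $A$ belongs to $A$. $A^{[m,n]}$ is the set of sequences in $A$ that are the identity outside $[m,n]$. $X^t$ (resp. $Y^t$) is the normal subgroup of sequences in $A$ that are the identity at all times $<t$ (resp. $>t$). Basis: for $t\in\mathbf{Z}$, $0\le k\le\ell$ put $\Lambda^{[t,t+k]}=X^{t+1}(X^t\cap Y^{t+k})/X^{t+1}(X^t\cap Y^{t+k-1})$. A basis is a choice, for each $(k,t)$, of a transversal $[\Lambda^{[t,t+k]}]$ whose elements (generators $\mathbf{g}^{[t,t+k]}$) lie in $A^{[t,t+k]}$ and in which the trivial coset is represented by the identity sequence. $\mathcal{R}=\prod_{t\in\mathbf{Z}}\prod_{0\le k\le\ell}[\Lambda^{[t,t+k]}]$. The map $\alpha:\mathcal{R}\to A$ sends $\mathbf{r}=(\mathbf{g}^{[t,t+k]})_{k,t}$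 to $\prod_{i=+\infty}^{-\infty}\prod_{m=0}^{\ell}\mathbf{g}^{[i,i+m]}$, i.e. the sequence with time-$t$ component $\prod_{j=0}^{\ell}\bigl(\prod_{k=j}^{\ell}\chi^t(\mathbf{g}^{[t-j,t-j+k]})\bigr)$ (factors written left to right in increasing $j$, and increasing $k$ for each $j$); $\alpha$ is a bijection. The operation $*$ on $\mathcal{R}$ is $\dot{\mathbf{r}}*\ddot{\mathbf{r}}=\alpha^{-1}(\alpha(\dot{\mathbf{r}})\alpha(\ddot{\mathbf{r}}))$. For each $(k,t)$ let $G_k^t$ be a set of labels with a fixed bijection $[\Lambda^{[t,t+k]}]\to G_k^t$, $\mathbf{g}^{[t,t+k]}\mapsto g_k^t$. $\mathcal{U}=\prod_{t\in\mathbf{Z}}\prod_{0\le k\le\ell}G_k^t$, and $\beta:\mathcal{R}\to\mathcal{U}$ replaces each generator by its label. The operation $\circ$ on $\mathcal{U}$ is $\beta(\dot{\mathbf{r}})\circ\beta(\ddot{\mathbf{r}})=\beta(\dot{\mathbf{r}}*\ddot{\mathbf{r}})$; $(\mathcal{U},\circ)$ is the generator group. *)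

(* Defs.v *)
From HB Require Import structures.
From mathcomp Require Import all_boot all_order all_algebra all_fingroup.
From mathcomp Require Import boolp classical_sets functions.

Set Implicit Arguments.
Unset Strict Implicit.
Unset Printing Implicit Defensive.

Import Order.TTheory GRing.Theory Num.Theory.

Local Open Scope classical_set_scope.
Local Open Scope group_scope.

Definition sequences (G : int -> finGroupType) : Type := forall t : int, G t.

HB.instance Definition _ (G : int -> finGroupType) :=
  Choice.copy (sequences G) (forall t : int, G t).

Section DirectProductGroup.
Variable G : int -> finGroupType.
Implicit Types a b c : sequences G.

Let mul a b : sequences G := fun t => a t * b t.
Let one : sequences G := fun=> 1.
Let inv a : sequences G := fun t => (a t)^-1.

Let mulA : associative mul.
Proof. by move=> a b c; apply/functional_extensionality_dep => t; exact: mulgA. Qed.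
Let mul1 : left_id one mul.
Proof. by move=> a; apply/functional_extensionality_dep => t; exact: mul1g. Qed.
Let mulr1 : right_id one mul.
Proof. by move=> a; apply/functional_extensionality_dep => t; exact: mulg1. Qed.
Let mulVl : left_inverse one inv mul.
Proof. by move=> a; apply/functional_extensionality_dep => t; exact: mulVg. Qed.
Let mulVr : right_inverse one inv mul.
Proof. by move=> a; apply/functional_extensionality_dep => t; exact: mulgV. Qed.

HB.instance Definition _ :=
  isGroup.Build (sequences G) mulA mul1 mulr1 mulVl mulVr.
End DirectProductGroup.

Section GroupSystem.
Variable G : int -> finGroupType.
Implicit Types (A D N S T : set (sequences G)) (a b : sequences G).
Implicit Types (s t m n : int).

Definition group_system A : Prop :=
  group_closed (mem A) /\ forall t (x : G t), exists2 a, A a & a t = x.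

Definition controllable (l : nat) A : Prop :=
  forall t a1 a2, A a1 -> A a2 ->
    exists a, [/\ A a,
      forall s, (s < t)%R -> a s = a1 s &
      forall s, (t + l%:Z <= s)%R -> a s = a2 s].

Definition complete_system A : Prop :=
  forall a,
    (forall m n, exists2 b, A b & forall s, (m <= s <= n)%R -> a s = b s) ->
    A a.

(* In the usual notation, supported_in A m n is A^{[m,n]}, future A t is X^t,
   past A t is Y^t, chain_term A t s is X^{t+1}(X^t :&: Y^s), and Lambda A t k
   is the quotient Lambda^{[t,t+k]}, given as the set of left cosets of its
   denominator, which is normal in A when A is a group. *)
Definition supported_in A m n : set (sequences G) :=
  [set a | A a /\ forall s, ~~ (m <= s <= n)%R -> a s = 1].

Definition future A t : set (sequences G) :=
  [set a | A a /\ forall s, (s < t)%R -> a s = 1].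

Definition past A t : set (sequences G) :=
  [set a | A a /\ forall s, (t < s)%R -> a s = 1].

Definition mulset S T : set (sequences G) :=
  [set a * b | a in S & b in T].

Definition chain_term A t s : set (sequences G) :=
  mulset (future A (t + 1)%R) (future A t `&` past A s).

Definition cosets N D : set (set (sequences G)) :=
  [set mulset [set g] D | g in N].

Definition Lambda A t (k : nat) : set (set (sequences G)) :=
  cosets (chain_term A t (t + k%:Z)%R) (chain_term A t (t + k%:Z - 1)%R).

Definition is_transversal T (Q : set (set (sequences G))) : Prop :=
  T `<=` \bigcup_(C in Q) C /\ forall C, Q C -> exists! g, (T `&` C) g.

Record basis A (l : nat) := Basis {
  generators :> int -> 'I_l.+1 -> set (sequences G);
  basis_transversal : forall t k, is_transversal (generators t k) (Lambda A t k);
  basis_supported : forall t k,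
    generators t k `<=` supported_in A t (t + (k : nat)%:Z)%R;
  basis1 : forall t k, generators t k 1
}.

End GroupSystem.

Section GeneratorGroup.
Variables (G : int -> finGroupType) (A : set (sequences G)) (l : nat).
Variable B : basis A l.

(* generator_array is the set R, and label_array below is the set U. *)
Definition generator_array : Type := forall (t : int) (k : 'I_l.+1), B t k.

HB.instance Definition _ := gen_eqMixin generator_array.
HB.instance Definition _ := gen_choiceMixin generator_array.

(* The product over 'I_l.+1 is taken in increasing index order, left to right. *)
Definition alpha (r : generator_array) : sequences G := fun t =>
  \prod_(j < l.+1) \prod_(k < l.+1 | (j <= k)%N)
    \val (r (t - (j : nat)%:Z)%R k) t.

Definition generator_array1 : generator_array :=
  fun t k => exist _ 1 (mem_set (basis1 B t k)).

(* The preimage of a under alpha. The default generator_array1 is only reached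
   outside the range of alpha. *)
Definition alpha_inv (a : sequences G) : generator_array :=
  xget generator_array1 [set r | alpha r = a].

Definition array_op (r1 r2 : generator_array) : generator_array :=
  alpha_inv (alpha r1 * alpha r2).

Record labelling (L : int -> 'I_l.+1 -> Type) := Labelling {
  label_of : forall t k, B t k -> L t k;
  generator_of : forall t k, L t k -> B t k;
  label_ofK : forall t k, cancel (@label_of t k) (@generator_of t k);
  generator_ofK : forall t k, cancel (@generator_of t k) (@label_of t k)
}.

Variables (L : int -> 'I_l.+1 -> Type) (lab : labelling L).

Definition label_array : Type := forall (t : int) (k : 'I_l.+1), L t k.

Definition beta (r : generator_array) : label_array :=
  fun t k => label_of lab (r t k).

Definition beta_inv (u : label_array) : generator_array :=
  fun t k => generator_of lab (u t k).

Definition generator_op (u1 u2 : label_array) : label_array :=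
  beta (array_op (beta_inv u1) (beta_inv u2)).

Definition f_u (u : label_array) : sequences G := fun t =>
  \prod_(j < l.+1) \prod_(k < l.+1 | (j <= k)%N)
    \val (generator_of lab (u (t - (j : nat)%:Z)%R k)) t.

End GeneratorGroup.

Definition group_law (T : Type) (op : T -> T -> T) : Prop :=
  exists (e : T) (inv : T -> T),
    [/\ associative op, left_id e op, right_id e op,
        left_inverse e inv op & right_inverse e inv op].

(* Main.v *)
Require Import Defs.
From mathcomp Require Import all_boot all_order all_algebra all_fingroup.
From mathcomp Require Import boolp classical_sets functions.
From mathcomp Require Import zify.

Local Open Scope classical_set_scope.

(** The time-t components of X^t /\ Y^(t+k) form a chain of normal subgroups of
    A^t, and controllability makes its top the group of all time-t components of
    X^t; each element of the top is thus uniquely a product, over k, of time-t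
    components of generators. Starting from a sequence of A which agrees with a
    before t, greedily chosen generators reproduce a at t, t + 1, and so on. Two
    such expansions differing only on a window of length m become, after one step
    at its left end, expansions differing on a window of length m - 1. Since the
    initial sequences can be taken trivial from time t + l on, l steps erase the
    dependence on them: this gives both uniqueness and existence of the two-sided
    expansion of a, hence the bijectivity of alpha and of f_u. *)

Section GroupSystemBasis.
Set Implicit Arguments.
Unset Strict Implicit.
Local Open Scope group_scope.
Import Order.TTheory GRing.Theory.
Implicit Types (m n : nat) (s t : int).

Variables (G : int -> finGroupType) (l : nat) (A : set (sequences G)).
Hypothesis A_group : group_system A.

Lemma seqM (a b : sequences G) t : (a * b) t = a t * b t.
Proof. by []. Qed.

Lemma seqV (a : sequences G) t : a^-1 t = (a t)^-1.
Proof. by []. Qed.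

Definition seqE := (seqM, seqV).

Lemma group_system1 : A 1.
Proof. by case: A_group => -[/set_mem]. Qed.

Lemma group_systemM a b : A a -> A b -> A (a * b).
Proof.
case: A_group => Agrp _ Aa Ab; apply: set_mem.
exact: (group_closedM Agrp (mem_set Aa) (mem_set Ab)).
Qed.

Lemma group_systemV a : A a -> A a^-1.
Proof.
case: A_group => Agrp _ Aa; apply: set_mem.
exact: (group_closedV Agrp (mem_set Aa)).
Qed.

(** * Time-[t] components of sequences in $X^t \cap Y^s$ *)

Definition head_group t s : set (G t) :=
  [set y t | y in future A t `&` past A s].
Arguments head_group : clear implicits.

Lemma head_group1 t s : head_group t s 1.
Proof. by exists 1 => //; split; split=> //; exact: group_system1. Qed.

Lemma head_groupM t s x y :
  head_group t s x -> head_group t s y -> head_group t s (x * y).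
Proof.
move=> [a [[Aa fa] [_ pa]] <-] [b [[Ab fb] [_ pb]] <-].
have Aab := group_systemM Aa Ab.
exists (a * b) => //; split; split=> // i ti.
  by rewrite !seqM fa// fb// mulg1.
by rewrite !seqM pa// pb// mulg1.
Qed.

Lemma head_groupV t s x : head_group t s x -> head_group t s x^-1.
Proof.
move=> [a [[Aa fa] [_ pa]] <-].
have Aa' := group_systemV Aa.
exists a^-1 => //; split; split=> // i ti.
  by rewrite seqV fa// invg1.
by rewrite seqV pa// invg1.
Qed.

(** Normality holds in all of [G t] because each [z] there is a component of some [c] in [A], and
    conjugation by [c] does not enlarge supports. *)
Lemma head_groupJ t s x z : head_group t s x -> head_group t s (x ^ z).
Proof.
have [_ /(_ t z) [c Ac <-]] := A_group.
move=> [a [[Aa fa] [_ pa]] <-].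
have Aa' : A (a ^ c).
  by apply: group_systemM; [exact: group_systemV|exact: group_systemM].
exists (a ^ c) => //; split; split=> // i ti.
  by rewrite /conjg !seqE fa// mul1g mulVg.
by rewrite /conjg !seqE pa// mul1g mulVg.
Qed.

Lemma head_groupS t s s' x :
  (s <= s')%R -> head_group t s x -> head_group t s' x.
Proof.
move=> ss' [a [fa [Aa pa]] <-]; exists a => //; split=> //; split=> // i ti.
by apply: pa; lia.
Qed.

Lemma head_group_trivial t s x : (s < t)%R -> head_group t s x -> x = 1.
Proof. by move=> st [a [_ [_ pa]] <-]; exact: pa. Qed.

(** On $X^t$ the kernel of evaluation at [t] is $X^{t+1}$, so a chain term is the full preimage of a
    head group. *)
Lemma chain_termE t s b :
  chain_term A t s b <-> future A t b /\ head_group t s (b t).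
Proof.
split=> [[c [Ac fc] [d [[Ad fd] pd] <-]]|[[Ab fb] [d [[Ad fd] pd] dt]]].
  split; first split.
  - exact: group_systemM.
  - by move=> i ti; rewrite !seqM fc ?fd ?mulg1 //; lia.
  - by exists d => //; rewrite !seqM fc ?mul1g //; lia.
exists (b * d^-1); last first.
  by exists d => //; exact: mulgKV.
split; first by apply: group_systemM => //; exact: group_systemV.
move=> i ti; have [->|it] := eqVneq i t.
  by rewrite !seqE dt mulgV.
by rewrite !seqE fb ?fd ?invg1 ?mulg1 //; lia.
Qed.

Lemma coset_chain_termE t s g b : future A t g ->
  mulset [set g] (chain_term A t s) b <->
  future A t b /\ head_group t s ((g t)^-1 * b t).
Proof.
move=> [Ag fg]; split=> [[_ -> [d /chain_termE[[Ad fd] hd] <-]]|[[Ab fb] hb]].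
  split; last by rewrite !seqM mulKg.
  split; first exact: group_systemM.
  by move=> i ti; rewrite !seqM fg// fd// mulg1.
exists g => //; exists (g^-1 * b); last exact: mulKVg.
apply/chain_termE; split=> //; split.
  by apply: group_systemM => //; exact: group_systemV.
by move=> i ti; rewrite !seqE fg// fb// invg1 mulg1.
Qed.

(** * Generators as coset representatives modulo head groups *)

Variable B : basis A l.

Lemma generatorP t k (g : B t k) : supported_in A t (t + (k : nat)%:Z)%R (val g).
Proof. exact: (basis_supported (set_mem (valP g))). Qed.

Lemma generator_eq1 t k (g : B t k) s :
  ~~ (t <= s <= t + (k : nat)%:Z)%R -> val g s = 1.
Proof. by case: (generatorP g) => _; exact. Qed.

Lemma generator_future t k (g : B t k) : future A t (val g).
Proof.
by case: (generatorP g) => ? g1; split=> // s st; apply: g1; lia.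
Qed.

Lemma generator_head t k (g : B t k) s :
  (t + (k : nat)%:Z <= s)%R -> head_group t s (val g t).
Proof.
case: (generatorP g) => Ag g1 ks; exists (val g) => //; split; split=> // i si;
  by apply: g1; lia.
Qed.

Lemma generator_inj t k (g h : B t k) :
  head_group t (t + (k : nat)%:Z - 1)%R ((val g t)^-1 * val h t) -> g = h.
Proof.
move=> gh.
pose C := mulset [set val g] (chain_term A t (t + (k : nat)%:Z - 1)%R).
have QC : Lambda A t k C.
  exists (val g) => //; apply/chain_termE; split; first exact: generator_future.
  exact: generator_head.
have Cg : C (val g).
  apply/coset_chain_termE; first exact: generator_future.
  by split; [exact: generator_future|rewrite mulVg; exact: head_group1].
have Ch : C (val h).
  apply/coset_chain_termE; first exact: generator_future.
  by split; [exact: generator_future|].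
have [_ /(_ _ QC) [c [_ uc]]] := basis_transversal B t k.
apply: val_inj => /=.
have <- := uc _ (conj (set_mem (valP g)) Cg).
exact: uc _ (conj (set_mem (valP h)) Ch).
Qed.

(** The membership hypothesis sits under the existential so that [cid] can choose a generator for
    every [x]. *)
Lemma generator_exists t (k : 'I_l.+1) x : exists g : B t k,
  head_group t (t + (k : nat)%:Z)%R x ->
  head_group t (t + (k : nat)%:Z - 1)%R (x * (val g t)^-1).
Proof.
have [hx|nhx] := pselect (head_group t (t + (k : nat)%:Z)%R x); last first.
  by exists (exist _ 1 (mem_set (basis1 B t k))).
have [a [fa _] ax] := hx.
have QC : Lambda A t k
    (mulset [set a] (chain_term A t (t + (k : nat)%:Z - 1)%R)).
  by exists a => //; apply/chain_termE; rewrite ax.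
have [_ /(_ _ QC) [c [[Bc /(coset_chain_termE _ _ fa)[fc hc]] _]]] :=
  basis_transversal B t k.
exists (exist _ c (mem_set Bc)) => _ /=.
(* The coset controls [x^-1 * c t], while peeling off a last factor needs the quotient on the right;
   normality converts one into the other. *)
have -> : x * (c t)^-1 = ((x^-1 * c t)^-1) ^ x^-1.
  by rewrite invMg invgK /conjg invgK mulgK.
by rewrite -ax; apply/head_groupJ/head_groupV.
Qed.

(** * Blocks: products of generators with a common start *)

Definition prefix_block t (g : forall k, B t k) n : sequences G :=
  \prod_(k < n) val (g (inord k)).

Definition block t (g : forall k, B t k) : sequences G :=
  \prod_(k < l.+1) val (g k).

Lemma blockE t (g : forall k, B t k) : block g = prefix_block g l.+1.
Proof. by apply: eq_bigr => k _; rewrite inord_val. Qed.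

Lemma prefix_blockS t (g : forall k, B t k) n :
  prefix_block g n.+1 = prefix_block g n * val (g (inord n)).
Proof. exact: big_ord_recr. Qed.

Lemma seq_prod I (r : seq I) (P : pred I) (F : I -> sequences G) t :
  (\prod_(i <- r | P i) F i) t = \prod_(i <- r | P i) F i t.
Proof. exact: (big_morph (fun a : sequences G => a t)). Qed.

Lemma block_system t (g : forall k, B t k) : A (block g).
Proof.
rewrite /block; elim/big_ind: _ => [|a b|k _].
- exact: group_system1.
- exact: group_systemM.
- by case: (generatorP (g k)).
Qed.

Lemma block_eq1 t (g : forall k, B t k) s :
  ~~ (t <= s <= t + l%:Z)%R -> block g s = 1.
Proof.
move=> ts; rewrite /block seq_prod big1// => k _; apply: generator_eq1.
have := ltn_ord k; lia.
Qed.

Lemma prefix_block_head t (g : forall k, B t k) n :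
  (n <= l.+1)%N -> head_group t (t + n%:Z - 1)%R (prefix_block g n t).
Proof.
elim: n => [|n IHn] nl; first by rewrite /prefix_block big_ord0; exact: head_group1.
rewrite prefix_blockS; apply: head_groupM.
  by apply: head_groupS (IHn (ltnW nl)); lia.
by apply: generator_head; rewrite inordK//; lia.
Qed.

(** The last factors agree modulo the head group of the shorter prefixes, which also absorbs [x] as
    long as [m <= n]; hence they are equal and cancel. *)
Lemma prefix_block_inj t (g h : forall k, B t k) m n x :
  (n <= l.+1)%N -> head_group t (t + m%:Z - 1)%R x ->
  prefix_block g n t = x * prefix_block h n t ->
  forall k : 'I_l.+1, (m <= k < n)%N -> g k = h k.
Proof.
move=> nl hx; elim: n nl => [|n IHn] nl; first by move=> _ k; lia.
have [nm|mn] := ltnP n m; first by move=> _ k; lia.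
rewrite !prefix_blockS => E.
have hg := prefix_block_head g (ltnW nl).
have hh := prefix_block_head h (ltnW nl).
have hx' : head_group t (t + n%:Z - 1)%R x by apply: head_groupS hx; lia.
have gh : g (inord n) = h (inord n).
  apply/esym/generator_inj; rewrite inordK//.
  have -> : (val (h (inord n)) t)^-1 * val (g (inord n)) t =
      ((prefix_block g n t)^-1 * (x * prefix_block h n t))
        ^ val (h (inord n)) t.
    apply: (@mulgI _ (val (h (inord n)) t)); rewrite mulKVg.
    apply: (@mulgI _ (prefix_block g n t)); move: E; rewrite !seqM => ->.
    by rewrite /conjg mulKVg -[_ * (x * _) * _]mulgA mulKVg mulgA.
  by apply: head_groupJ; apply: head_groupM; [exact: head_groupV|exact: head_groupM].
move=> k /andP[mk]; rewrite ltnS leq_eqVlt => /orP[/eqP kn|kn].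
  by have -> : k = inord n by rewrite -kn inord_val.
apply: (IHn (ltnW nl)); last by rewrite mk.
by move: E; rewrite gh !seqM mulgA => /mulIg.
Qed.

(** The rightmost generator is chosen first, so that what remains of [x] falls one level down the
    chain, whose bottom is trivial. *)
Lemma prefix_block_surj t n x : (n <= l.+1)%N ->
  head_group t (t + n%:Z - 1)%R x ->
  exists g : forall k, B t k, prefix_block g n t = x.
Proof.
elim: n x => [|n IHn] x nl hx.
  exists (fun k => exist _ 1 (mem_set (basis1 B t k))).
  by rewrite /prefix_block big_ord0 (head_group_trivial _ hx)//; lia.
pose e k := projT1 (cid (generator_exists k x)).
have {hx} /(projT2 (cid (generator_exists (inord n) x))) :
    head_group t (t + (inord n : 'I_l.+1)%:Z)%R x.
  by rewrite inordK//; apply: head_groupS hx; lia.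
rewrite -/(e _) inordK// => /(IHn _ (ltnW nl)) [g gx].
exists (fun k => if k == inord n then e k else g k).
rewrite prefix_blockS eqxx {1}seqM -[RHS](mulgKV (val (e (inord n)) t)).
congr (_ * _); rewrite -gx; congr (_ t).
apply: eq_bigr => k _; have kn := ltn_ord k.
suff /negPf -> : inord k != inord n :> 'I_l.+1 by [].
by rewrite -val_eqE /= !inordK//; lia.
Qed.

(* Two partial expansions which agree off [t, t + m) and are both extended
   correctly at time t agree off [t + 1, t + m): only the components k >= m of
   the block are forced, but the window of disagreement loses its left end. *)
Lemma block_contraction t (g h : forall k, B t k) p q m : A p -> A q ->
  (forall s, ~~ (t <= s < t + m%:Z)%R -> p s = q s) ->
  (block g * p) t = (block h * q) t ->
  (forall k : 'I_l.+1, (m <= k)%N -> g k = h k) /\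
  forall s, ~~ (t + 1 <= s < t + m%:Z)%R -> (block g * p) s = (block h * q) s.
Proof.
move=> Ap Aq pq gphq.
have gh (k : 'I_l.+1) : (m <= k)%N -> g k = h k.
  move=> mk; apply: (@prefix_block_inj t g h m l.+1
    ((q t * (p t)^-1) ^ (block h t)^-1)) => //; last by rewrite mk ltn_ord.
  - apply: head_groupJ; exists (q * p^-1) => //.
    have Aqp : A (q * p^-1) by apply: group_systemM => //; exact: group_systemV.
    by split; split=> // i ti; rewrite !seqE pq ?mulgV//; lia.
  - rewrite -!blockE /conjg invgK; apply: (@mulIg _ (p t)).
    by move: gphq; rewrite !seqM => ->; rewrite !mulgA !mulgKV.
split=> // s sm; have [->//|st] := eqVneq s t.
rewrite !seqM pq; last by lia.
congr (_ * _); rewrite /block !seq_prod; apply: eq_bigr => k _.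
have [/gh ->//|km] := leqP m k.
by rewrite !generator_eq1//; lia.
Qed.

(** * Expansions and their truncations *)

Hypotheses (A_controllable : controllable l A) (A_complete : complete_system A).

Lemma alphaE (r : generator_array B) t :
  alpha r t = \prod_(j < l.+1) block (r (t - (j : nat)%:Z)%R) t.
Proof.
apply: eq_bigr => j _; rewrite /block seq_prod big_mkcond.
apply: eq_bigr => k _; case: ifPn => // jk.
by rewrite generator_eq1//; lia.
Qed.

Lemma alpha_system (r : generator_array B) : A (alpha r).
Proof.
apply: A_complete => m n.
pose N := `|n - m|%N.
(* Only the finitely many blocks starting in [[m - l, n]] can be nontrivial on [[m, n]]. *)
exists (\prod_(i < (N + l).+1) block (r (n - (i : nat)%:Z)%R)).
  elim/big_ind: _ => [|a b|i _]; [exact: group_system1|exact: group_systemM|].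
  exact: block_system.
move=> s /andP[ms sn]; rewrite alphaE seq_prod.
have dE : (`|n - s|%N%:Z = n - s)%R by lia.
have dN : (`|n - s| <= N)%N by rewrite /N; lia.
move: `|n - s|%N dE dN => d dE dN.
(* The first [d] blocks start after [s] and the last [N - d] end before it; the middle [l + 1] give
   [alpha r s]. *)
have -> : (N + l).+1 = (d + (l.+1 + (N - d)))%N by lia.
rewrite !big_split_ord /= [X in _ = X * _]big1 ?mul1g; last first.
  by move=> i _; apply: block_eq1; have := ltn_ord i; lia.
rewrite [X in _ = _ * X]big1 ?mulg1; last first.
  by move=> i _; apply: block_eq1; have := ltn_ord i; lia.
apply: eq_bigr => j _; congr (block (r _) s); lia.
Qed.

Definition truncate (r : generator_array B) t : generator_array B :=
  fun i k => if (i < t)%R then r i k else generator_array1 B i k.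

Lemma block1 t : block (generator_array1 B t) = 1.
Proof. by rewrite /block big1. Qed.

Lemma block_truncate r t i : block (truncate r t i) = if (i < t)%R then block (r i) else 1.
Proof.
case: ifPn => it; last rewrite -(block1 i); apply: eq_bigr => k _.
  by rewrite /truncate it.
by rewrite /truncate (negPf it).
Qed.

Lemma alpha_truncate_lt r t s : (s < t)%R -> alpha (truncate r t) s = alpha r s.
Proof.
move=> st; rewrite !alphaE; apply: eq_bigr => j _.
by rewrite block_truncate ifT//; lia.
Qed.

Lemma alpha_truncate_ge r t s : (t + l%:Z <= s)%R -> alpha (truncate r t) s = 1.
Proof.
move=> ts; rewrite alphaE big1// => j _.
by rewrite block_truncate ifF//; have := ltn_ord j; lia.
Qed.

Lemma alpha_truncateS r t :
  alpha (truncate r (t + 1)%R) = block (r t) * alpha (truncate r t).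
Proof.
apply/functional_extensionality_dep => s; rewrite {1}seqM !alphaE.
have [st|ts] := ltP s t.
  rewrite block_eq1 ?mul1g; last by lia.
  by apply: eq_bigr => j _; rewrite !block_truncate !ifT//; lia.
have [ls|sl] := ltP (t + l%:Z)%R s.
  rewrite block_eq1 ?mul1g; last by lia.
  by apply: eq_bigr => j _; rewrite !block_truncate !ifF//; have := ltn_ord j; lia.
have : (`|s - t|%N%:Z = s - t)%R by lia.
move: `|s - t|%N => d dE.
have -> : l.+1 = (d + (1 + (l - d)))%N by lia.
rewrite !big_split_ord /= !big_ord1 /=.
rewrite big1 ?mul1g; last first.
  by move=> i _; rewrite block_truncate ifF//; have := ltn_ord i; lia.
rewrite [X in _ = _ * (X * _)]big1 ?mul1g; last first.
  by move=> i _; rewrite block_truncate ifF//; have := ltn_ord i; lia.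
rewrite !block_truncate ifT ?ifF ?mul1g; [|lia..].
congr (_ * _); first by congr (block (r _) s); lia.
by apply: eq_bigr => i _; rewrite !block_truncate !ifT//; lia.
Qed.

(** * Uniqueness of the expansion *)

Lemma alpha_inj : injective (@alpha _ _ _ B).
Proof.
move=> r r' rr'.
(* The truncations at [t] agree before [t] and are trivial from [t + l] on, so they differ at most
   on a window of length [l], which loses one position per step. *)
have contr t n : (n <= l)%N -> forall s, ~~ (t + n%:Z <= s < t + l%:Z)%R ->
    alpha (truncate r (t + n%:Z)%R) s = alpha (truncate r' (t + n%:Z)%R) s.
  elim: n => [_ s ts|n IHn nl s].
    rewrite addr0 in ts *; have [st|st] := ltP s t.
      by rewrite !alpha_truncate_lt// rr'.
    by rewrite !alpha_truncate_ge//; lia.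
  have -> : (t + n.+1%:Z = t + n%:Z + 1)%R by lia.
  rewrite !alpha_truncateS.
  have [] := @block_contraction (t + n%:Z)%R (r (t + n%:Z)%R) (r' (t + n%:Z)%R)
    _ _ (l - n) (alpha_system (truncate r (t + n%:Z)%R))
                (alpha_system (truncate r' (t + n%:Z)%R)).
  - by move=> i ti; apply: IHn; lia.
  - by rewrite -!alpha_truncateS !alpha_truncate_lt ?rr'//; lia.
  - by move=> _ E st; apply: E; lia.
apply: functional_extensionality_dep => t.
apply: functional_extensionality_dep => k.
(* After [l] steps from [t - l] the window is empty: the truncations at [t] coincide, and [m = 0]
   forces every component of the block. *)
have [] := @block_contraction t (r t) (r' t) _ _ 0
  (alpha_system (truncate r t)) (alpha_system (truncate r' t)).
- move=> s _; have := contr (t - l%:Z)%R l (leqnn l) s.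
  by rewrite subrK; apply; lia.
- by rewrite -!alpha_truncateS !alpha_truncate_lt ?rr'//; lia.
- by move=> /(_ k (leq0n _)).
Qed.

(** * Existence of the expansion *)

Lemma head_group_controllable t a : future A t a -> head_group t (t + l%:Z)%R (a t).
Proof.
move=> [Aa fa].
(* Splicing at [t + 1] keeps the component at [t] and kills everything after [t + l]. *)
have [c [Ac clt cge]] := A_controllable (t + 1)%R Aa group_system1.
exists c; last by apply: clt; lia.
split; split=> // s ts; last by apply: cge; lia.
by rewrite clt ?fa//; lia.
Qed.

Lemma block_surj t x : exists g : forall k, B t k,
  head_group t (t + l%:Z)%R x -> block g t = x.
Proof.
have [hx|nhx] := pselect (head_group t (t + l%:Z)%R x); last first.
  by exists (generator_array1 B t).
have [|g gx] := @prefix_block_surj t l.+1 x (leqnn _).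
  by apply: head_groupS hx; lia.
by exists g => _; rewrite blockE.
Qed.

Definition decompose t (x : G t) : forall k, B t k := projT1 (cid (block_surj x)).

Lemma decomposeK t x :
  head_group t (t + l%:Z)%R x -> block (decompose x) t = x.
Proof. exact: projT2 (cid (block_surj x)). Qed.

Section Surjectivity.
Variables (a : sequences G) (Aa : A a).

Definition extend t (p : sequences G) : sequences G :=
  block (decompose (a t * (p t)^-1)) * p.

Fixpoint extend_iter t p n : sequences G :=
  if n is n'.+1 then extend (t + n'%:Z)%R (extend_iter t p n') else p.

(** Splitting off the earliest step, not the latest, allows comparing expansions begun at [t] and at
    [t + 1]. *)
Lemma extend_iterS t p n :
  extend_iter t p n.+1 = extend_iter (t + 1)%R (extend t p) n.
Proof.
elim: n => [|n IHn]; first by rewrite /= addr0.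
rewrite [LHS]/= -/(extend_iter t p n.+1) IHn /=; congr extend; lia.
Qed.

Definition initial t p := A p /\ forall s, (s < t)%R -> p s = a s.

(** As [p] agrees with [a] before [t], [a * p^-1] lies in $X^t$, and controllability lets a block
    supply its component at [t]. *)
Lemma extend_initial t p : initial t p -> initial (t + 1)%R (extend t p).
Proof.
move=> [Ap pa]; split; first by apply: group_systemM => //; exact: block_system.
move=> s st; rewrite /extend !seqM.
have [->|ns] := eqVneq s t; last by rewrite block_eq1 ?mul1g ?pa//; lia.
rewrite decomposeK ?mulgKV//.
apply: (@head_group_controllable t (a * p^-1)); split.
  by apply: group_systemM => //; exact: group_systemV.
by move=> i it; rewrite !seqE pa// mulgV.
Qed.

Lemma extend_iter_initial t p n :
  initial t p -> initial (t + n%:Z)%R (extend_iter t p n).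
Proof.
move=> ip; elim: n => [|n IHn]; first by rewrite addr0.
have -> : (t + n.+1%:Z = t + n%:Z + 1)%R by lia.
exact: extend_initial.
Qed.

(** For [n = l] the window is empty, so the choice of initial sequence is forgotten. *)
Lemma extend_iter_contraction t p q n : initial t p -> initial t q ->
  (n <= l)%N ->
  (forall s, (t + l%:Z <= s)%R -> p s = q s) ->
  forall s, ~~ (t + n%:Z <= s < t + l%:Z)%R ->
  extend_iter t p n s = extend_iter t q n s.
Proof.
move=> ip iq nl pq; elim: n nl => [_ s ts|n IHn nl s ts].
  have [st|st] := ltP s t; last by apply: pq; lia.
  by move: ip iq => [_ pa] [_ qa]; rewrite /= pa ?qa.
have [Ap _] := extend_iter_initial n ip; have [Aq _] := extend_iter_initial n iq.
have /extend_initial[_ Ep] := extend_iter_initial n ip.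
have /extend_initial[_ Eq] := extend_iter_initial n iq.
have [] := block_contraction (t := (t + n%:Z)%R) (m := (l - n)%N)
  (g := decompose (a (t + n%:Z)%R * (extend_iter t p n (t + n%:Z)%R)^-1))
  (h := decompose (a (t + n%:Z)%R * (extend_iter t q n (t + n%:Z)%R)^-1))
  Ap Aq.
- by move=> i ti; apply: IHn; lia.
- by rewrite -/(extend _ _) -/(extend _ _) Ep ?Eq//; lia.
- by move=> _ E; apply: E; lia.
Qed.

Lemma past_segment_exists t : exists p,
  initial t p /\ forall s, (t + l%:Z <= s)%R -> p s = 1.
Proof.
have [p [Ap plt pge]] := A_controllable t Aa group_system1.
by exists p.
Qed.

(* Any l consecutive extension steps forget the initial choice, so these
   partial expansions fit together into a single two-sided expansion. *)
Definition partial_expansion t : sequences G :=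
  extend_iter (t - l%:Z)%R (projT1 (cid (past_segment_exists (t - l%:Z)%R))) l.

Lemma partial_expansion_initial t : initial t (partial_expansion t).
Proof.
rewrite /partial_expansion; case: cid => p [ip _] /=.
by have := extend_iter_initial l ip; rewrite subrK.
Qed.

Lemma partial_expansionS t :
  partial_expansion (t + 1)%R = extend t (partial_expansion t).
Proof.
rewrite /partial_expansion; case: cid => q [iq q1] /=; case: cid => p [ip p1] /=.
(* Both sides become [l] steps from [t - l + 1], begun at [q] and at one extension of [p], both
   trivial from [t + 1] on. *)
have E : (t + 1 - l%:Z = t - l%:Z + 1)%R by lia.
rewrite E in iq q1 *.
have -> : extend t (extend_iter (t - l%:Z)%R p l) = extend_iter (t - l%:Z)%R p l.+1.
  by rewrite /= addrNK.
rewrite extend_iterS; apply/functional_extensionality_dep => s.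
apply: extend_iter_contraction; rewrite ?leqnn//.
- exact: extend_initial.
- move=> i ti; rewrite q1; last by lia.
  rewrite /extend !seqM block_eq1 ?p1 ?mulg1//; lia.
- by lia.
Qed.

Lemma extend_iter_eq1 t p n s : (forall i, (t + l%:Z <= i)%R -> p i = 1) ->
  (t + l%:Z + n%:Z <= s)%R -> extend_iter t p n s = 1.
Proof.
move=> p1; elim: n => [|n IHn] ts /=; first by apply: p1; lia.
rewrite /extend {1}seqM block_eq1 ?mul1g ?IHn//; lia.
Qed.

Lemma partial_expansion_eq1 t s : (t + l%:Z <= s)%R -> partial_expansion t s = 1.
Proof.
rewrite /partial_expansion; case: cid => p [_ p1] /= ts.
by apply: extend_iter_eq1 => //; lia.
Qed.

Lemma alpha_surj : exists r : generator_array B, alpha r = a.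
Proof.
pose r : generator_array B :=
  fun t => decompose (a t * (partial_expansion t t)^-1).
exists r; apply/functional_extensionality_dep => t; rewrite alphaE.
(* [partial_expansion (t + 1)] equals [a] at [t], and each step back releases the next block of
   [alpha r]. *)
have expand n : a t = (\prod_(j < n) block (r (t - (j : nat)%:Z)%R) t) *
    partial_expansion (t + 1 - n%:Z)%R t.
  elim: n => [|n IHn].
    rewrite big_ord0 mul1g subr0.
    by case: (partial_expansion_initial (t + 1)%R) => _ ->//; lia.
  rewrite big_ord_recr /= -mulgA IHn; congr (_ * _).
  have -> : (t + 1 - n%:Z = t - n%:Z + 1)%R by lia.
  have -> : (t + 1 - n.+1%:Z = t - n%:Z)%R by lia.
  by rewrite partial_expansionS.
(* After [l + 1] steps the remainder is [partial_expansion (t - l)], already trivial at [t]. *)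
rewrite (expand l.+1) partial_expansion_eq1 ?mulg1//; lia.
Qed.

End Surjectivity.

End GroupSystemBasis.

(** * Transfer to the generator group *)

Theorem theorem36 (G : int -> finGroupType) (l : nat) (A : set (sequences G))
  (B : basis A l) (L : int -> 'I_l.+1 -> Type) (lab : labelling B L) :
  (0 < l)%N -> group_system A -> controllable l A -> complete_system A ->
  [/\ group_law (generator_op lab),
      {morph f_u lab : u v / generator_op lab u v >-> (u * v)%g},
      set_bij [set: label_array L] A (f_u lab),
      range (f_u lab) = A &
      [/\ group_system (range (f_u lab)),
          controllable l (range (f_u lab)) &
          complete_system (range (f_u lab))]].
Proof.
move=> _ Agrp Actrl Acomp.
have f_inj : injective (f_u lab).
  move=> u v /(alpha_inj Agrp Acomp (x1 := beta_inv lab u) (x2 := beta_inv lab v)).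
  move=> uv; apply: functional_extensionality_dep => t.
  apply: functional_extensionality_dep => k.
  rewrite -(generator_ofK lab (u t k)) -(generator_ofK lab (v t k)).
  by congr label_of; exact: (congr1 (fun r => r t k) uv).
have alpha_f r : f_u lab (beta lab r) = alpha r.
  have rK : beta_inv lab (beta lab r) = r.
    apply: functional_extensionality_dep => t.
    by apply: functional_extensionality_dep => k; exact: label_ofK.
  exact: (congr1 (@alpha _ _ _ B) rK).
have f_A u : A (f_u lab u) by exact: (alpha_system Agrp Acomp (beta_inv lab u)).
have f_surj a : A a -> exists u, f_u lab u = a.
  by move=> /(alpha_surj Agrp B Actrl)[r <-]; exists (beta lab r).
have f_range : range (f_u lab) = A.
  by apply/seteqP; split=> [_ [u _ <-]//|a /f_surj[u]]; exists u.
have f_morph : {morph f_u lab : u v / generator_op lab u v >-> (u * v)%g}.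
  move=> u v; rewrite /generator_op alpha_f /array_op /alpha_inv.
  (* Surjectivity of [alpha] ensures that [alpha_inv] returns a true preimage and not its
     default. *)
  apply: (xgetPex _ (P := [set r | alpha r = _])).
  apply: (alpha_surj Agrp B Actrl); exact: group_systemM Agrp _ _ (f_A u) (f_A v).
split=> //; last by rewrite f_range.
(* The group axioms are pulled back along the injective morphism [f_u], with unit and inverses
   chosen as preimages. *)
- have [e fe] := f_surj _ (group_system1 Agrp).
  pose inv u := projT1 (cid (f_surj _ (group_systemV Agrp (f_A u)))).
  have finv u : f_u lab (inv u) = ((f_u lab u)^-1)%g by rewrite /inv; case: cid.
  exists e, inv; split=> [u v w|u|u|u|u]; apply: f_inj;
    by rewrite !f_morph ?fe ?finv ?mulgA ?mul1g ?mulg1 ?mulVg ?mulgV.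
- split=> [u _|u v _ _|a /f_surj[u fu]]; [exact: f_A|exact: f_inj|].
  by exists u.
Qed.
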